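(* Let $n\ge1$, $\sigma=\{\sigma_1,\dots,\sigma_n\}$, and let $k$ be a $\sigma$-field. Let $G$ be a $\sigma$-algebraic group over $k$. Then $G$ is isomorphic to a $\sigma$-closed subgroup of $\operatorname{GL}_s$ over $k$ for some $s\geq 1$.
   Context: All rings are commutative with unit. A $\sigma$-ring is a ring with $n$ pairwise commuting ring endomorphisms $\sigma_1,\dots,\sigma_n$; a $\sigma$-field is a $\sigma$-ring that is a field. A $k$-$\sigma$-algebra is a $\sigma$-ring $R$ that is a $k$-algebra via a ring morphism $k\to R$ commuting with all $\sigma_j$; morphisms are $k$-algebra morphisms commuting with all $\sigma_j$. It is finitely $\sigma$-generated if it is generated as a $k$-algebra by all images of some finite subset under compositions of the $\sigma_j$. A $\sigma$-algebraic group over $k$ is a functor $G$ from the category of $k$-$\sigma$-algebras to groups which, as a functor to sets, is represented by a finitely $\sigma$-generated $k$-$\sigma$-algebra $k\{G\}$ (then a $k$-$\sigma$-Hopf algebra, i.e. a $k$-Hopf algebra whose structure maps commute with the $\sigma_j$). Morphisms are natural transformations of group-valued functors. Here $\operatorname{GL}_s$ denotes the $\sigma$-algebraic group sending a $k$-$\sigma$-algebra $R$ to the group of invertible $s\times s$ matrices over $R$. A $\sigma$-closed subgroup of a $\sigma$-algebraic group $H$ is a subgroup functor of the form $R\mapsto\{x\in\operatorname{Hom}(k\{H\},R)=H(R)\mid x(I)=0\}$ for a $\sigma$-Hopf ideal $I\subseteq k\{H\}$ (a Hopf ideal with $\sigma_j(I)\subseteq I$ for all $j$). *)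

(* Defs.v *)
From HB Require Import structures.
From mathcomp Require Import all_boot all_algebra.
From mathcomp Require Import generic_quotient boolp.

Set Implicit Arguments.
Unset Strict Implicit.
Unset Printing Implicit Defensive.

Import GRing.Theory.
Local Open Scope ring_scope.
Local Open Scope quotient_scope.

(* Rings are [comPzRingType]s, so that the zero ring is allowed. *)
Record sigmaStruct (n : nat) (R : comPzRingType) := SigmaStruct {
  endo : 'I_n -> {rmorphism R -> R};
  endoC : forall (i j : 'I_n) (x : R), endo i (endo j x) = endo j (endo i x)
}.

Record sigmaField (n : nat) := SigmaField {
  sf_field :> fieldType;
  sf_struct : sigmaStruct n sf_field
}.

Record sigmaAlgebra (n : nat) (k : sigmaField n) := SigmaAlgebra {
  sa_ring :> comPzRingType;
  sa_struct : sigmaStruct n sa_ring;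
  sa_in : {rmorphism k -> sa_ring};
  sa_inE : forall (j : 'I_n) (c : k),
    sa_in (endo (sf_struct k) j c) = endo sa_struct j (sa_in c)
}.

Notation "''s_' j" := (endo (sa_struct _) j)
  (at level 8, j at level 2, format "''s_' j").
Notation "c %:k" := (sa_in _ c) (at level 2, left associativity, format "c %:k").

Record sigmaHom (n : nat) (k : sigmaField n) (A B : sigmaAlgebra k) := SigmaHom {
  sh_map :> {rmorphism A -> B};
  sh_in : forall c : k, sh_map c%:k = c%:k;
  sh_sigma : forall (j : 'I_n) (a : A), sh_map ('s_j a) = 's_j (sh_map a)
}.

Section Category.
Variables (n : nat) (k : sigmaField n).
Implicit Types A B C : sigmaAlgebra k.

Definition base_alg : sigmaAlgebra k :=
  @SigmaAlgebra n k k (sf_struct k) idfun (fun _ _ => erefl).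

Definition idHom A : sigmaHom A A :=
  @SigmaHom n k A A idfun (fun _ => erefl) (fun _ _ => erefl).

Section Comp.
Variables (A B C : sigmaAlgebra k) (g : sigmaHom B C) (f : sigmaHom A B).

Fact compHom_in c : (g \o f) c%:k = c%:k.
Proof. by rewrite /= !sh_in. Qed.

Fact compHom_sigma j a : (g \o f) ('s_j a) = 's_j ((g \o f) a).
Proof. by rewrite /= !sh_sigma. Qed.

Definition compHom : sigmaHom A C := SigmaHom compHom_in compHom_sigma.
End Comp.

(* Closure under opposites follows from that under products, as -1 is in k. *)
Definition subalgebra A (P : A -> Prop) : Prop :=
  [/\ forall c : k, P c%:k,
      forall x y, P x -> P y -> P (x + y)
    & forall x y, P x -> P y -> P (x * y)].

Definition sigma_word A (w : seq 'I_n) (a : A) : A :=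
  foldr (fun j (x : A) => 's_j x) a w.

Definition sigma_generates A (s : seq A) : Prop :=
  forall P : A -> Prop, subalgebra P ->
    (forall w a, a \in s -> P (sigma_word w a)) -> forall x, P x.

Definition finitely_sigma_generated A : Prop :=
  exists s : seq A, sigma_generates s.

End Category.

Record groupFunctor (n : nat) (k : sigmaField n) := GroupFunctor {
  gf_obj :> sigmaAlgebra k -> groupType;
  gf_map : forall R S : sigmaAlgebra k, sigmaHom R S -> gf_obj R -> gf_obj S;
  gf_mapM : forall (R S : sigmaAlgebra k) (f : sigmaHom R S) (x y : gf_obj R),
    gf_map f (x * y)%g = (gf_map f x * gf_map f y)%g;
  gf_map_id : forall (R : sigmaAlgebra k) (x : gf_obj R), gf_map (idHom R) x = x;
  gf_map_comp : forall (R S T : sigmaAlgebra k) (g : sigmaHom S T)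
      (f : sigmaHom R S) (x : gf_obj R),
    gf_map (compHom g f) x = gf_map g (gf_map f x)
}.

Record groupFunctorHom (n : nat) (k : sigmaField n) (G H : groupFunctor k) :=
  GroupFunctorHom {
  gh_map :> forall R : sigmaAlgebra k, G R -> H R;
  gh_mapM : forall (R : sigmaAlgebra k) (x y : G R),
    gh_map (x * y)%g = (gh_map x * gh_map y)%g;
  gh_natural : forall (R S : sigmaAlgebra k) (f : sigmaHom R S) (x : G R),
    gh_map (gf_map f x) = gf_map f (gh_map x)
}.

Definition groupFunctor_iso (n : nat) (k : sigmaField n) (G H : groupFunctor k) :
    Prop :=
  exists (f : groupFunctorHom G H) (g : groupFunctorHom H G),
    forall R : sigmaAlgebra k, cancel (f R) (g R) /\ cancel (g R) (f R).

(* [coord G] is k{G}; [ev] and [pt] are the identification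
   G(R) = Hom(k{G}, R), natural in R. *)
Record sigmaAlgGroup (n : nat) (k : sigmaField n) := SigmaAlgGroup {
  sag_functor :> groupFunctor k;
  coord : sigmaAlgebra k;
  coord_fg : finitely_sigma_generated coord;
  ev : forall R : sigmaAlgebra k, sag_functor R -> sigmaHom coord R;
  pt : forall R : sigmaAlgebra k, sigmaHom coord R -> sag_functor R;
  evK : forall (R : sigmaAlgebra k) (x : sag_functor R), pt (ev x) = x;
  ptK : forall (R : sigmaAlgebra k) (f : sigmaHom coord R) (a : coord),
    ev (pt f) a = f a;
  ev_natural : forall (R S : sigmaAlgebra k) (f : sigmaHom R S)
      (x : sag_functor R) (a : coord),
    ev (gf_map f x) a = f (ev x a)
}.

Record subgroupFunctor (n : nat) (k : sigmaField n) (H : groupFunctor k) :=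
  SubgroupFunctor {
  sub_mem : forall R : sigmaAlgebra k, {pred H R};
  sub_closed : forall R : sigmaAlgebra k, group_closed (@sub_mem R);
  sub_map : forall (R S : sigmaAlgebra k) (f : sigmaHom R S) (x : H R),
    x \in @sub_mem R -> gf_map f x \in @sub_mem S
}.

Arguments sub_mem {n k H} s R.

Section SubgroupFunctor.
Variables (n : nat) (k : sigmaField n) (H : groupFunctor k) (S : subgroupFunctor H).

Definition sub_obj (R : sigmaAlgebra k) := {x : H R | x \in sub_mem S R}.

HB.instance Definition _ R := SubChoice.on (sub_obj R).
HB.instance Definition _ R :=
  SubChoice_isSubGroup.Build (H R) _ (sub_obj R) (sub_closed S R).

Definition sub_gf_map (R T : sigmaAlgebra k) (f : sigmaHom R T) (x : sub_obj R) :
    sub_obj T :=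
  exist _ (gf_map f (val x)) (sub_map f (valP x)).

Fact sub_gf_mapM R T (f : sigmaHom R T) (x y : sub_obj R) :
  sub_gf_map f (x * y)%g = (sub_gf_map f x * sub_gf_map f y)%g.
Proof. by apply: val_inj; rewrite /= gf_mapM. Qed.

Fact sub_gf_map_id R (x : sub_obj R) : sub_gf_map (idHom R) x = x.
Proof. by apply: val_inj; rewrite /= gf_map_id. Qed.

Fact sub_gf_map_comp R T U (g : sigmaHom T U) (f : sigmaHom R T) (x : sub_obj R) :
  sub_gf_map (compHom g f) x = sub_gf_map g (sub_gf_map f x).
Proof. by apply: val_inj; rewrite /= gf_map_comp. Qed.

Definition sub_functor : groupFunctor k :=
  @GroupFunctor n k sub_obj sub_gf_map sub_gf_mapM sub_gf_map_id sub_gf_map_comp.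
End SubgroupFunctor.

Section Tensor.
Variables (n : nat) (k : sigmaField n) (A B : sigmaAlgebra k).
Implicit Types s t u : seq (A * B).

(* A sequence of pairs (a_i, b_i) stands for the sum of the a_i (x) b_i. *)
Inductive tens_rel : seq (A * B) -> seq (A * B) -> Prop :=
| tr_refl s : tens_rel s s
| tr_sym s t : tens_rel s t -> tens_rel t s
| tr_trans s t u : tens_rel s t -> tens_rel t u -> tens_rel s u
| tr_cat s s' t t' :
    tens_rel s s' -> tens_rel t t' -> tens_rel (s ++ t) (s' ++ t')
| tr_catC s t : tens_rel (s ++ t) (t ++ s)
| tr_addl a a' b : tens_rel [:: (a + a', b)] [:: (a, b); (a', b)]
| tr_addr a b b' : tens_rel [:: (a, b + b')] [:: (a, b); (a, b')]
| tr_0l b : tens_rel [:: (0, b)] [::]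
| tr_scal c a b : tens_rel [:: (c%:k * a, b)] [:: (a, c%:k * b)].
Hint Resolve tr_refl : core.

Definition tens_relb : rel (seq (A * B)) := fun s t => `[< tens_rel s t >].

Fact tens_relb_refl : reflexive tens_relb.
Proof. by move=> s; apply/asboolP. Qed.

Fact tens_relb_sym : symmetric tens_relb.
Proof. by move=> s t; apply/asboolP/asboolP; apply: tr_sym. Qed.

Fact tens_relb_trans : transitive tens_relb.
Proof.
by move=> t s u /asboolP st /asboolP tu; apply/asboolP; apply: tr_trans tu.
Qed.

Canonical tens_equiv := EquivRel tens_relb tens_relb_refl tens_relb_sym
  tens_relb_trans.

Definition tensor := {eq_quot tens_equiv}.
HB.instance Definition _ := Choice.on tensor.

Definition tens_sum (s : seq (A * B)) : tensor := \pi_({eq_quot tens_equiv}) s.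
Definition tens_repr (x : tensor) : seq (A * B) := repr x.

Lemma tens_sumP s t : tens_sum s = tens_sum t <-> tens_rel s t.
Proof. by split=> [/eqmodP/asboolP|st] //; apply/eqmodP/asboolP. Qed.

Lemma tens_reprK x : tens_sum (tens_repr x) = x.
Proof. exact: reprK. Qed.

Lemma tens_ex x : exists s, x = tens_sum s.
Proof. by exists (tens_repr x); rewrite tens_reprK. Qed.

Lemma tens_reprP s : tens_rel (tens_repr (tens_sum s)) s.
Proof. by apply/tens_sumP; rewrite tens_reprK. Qed.

Lemma tens_rel_opp s t : tens_rel s t ->
  tens_rel [seq (- x.1, x.2) | x <- s] [seq (- x.1, x.2) | x <- t].
Proof.
elim=> {s t} //=.
- by move=> s t _; apply: tr_sym.
- by move=> s t u _ st _; apply: tr_trans.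
- by move=> s s' t t' _ ? _ ?; rewrite !map_cat; apply: tr_cat.
- by move=> s t; rewrite !map_cat; apply: tr_catC.
- by move=> a a' b; rewrite opprD; apply: tr_addl.
- by move=> a b b'; apply: tr_addr.
- by move=> b; rewrite oppr0; apply: tr_0l.
- by move=> c a b; rewrite -mulrN; apply: tr_scal.
Qed.

Definition tens_add (x y : tensor) := tens_sum (tens_repr x ++ tens_repr y).
Definition tens_opp (x : tensor) :=
  tens_sum [seq (- p.1, p.2) | p <- tens_repr x].

Fact tens_add_sum s t : tens_add (tens_sum s) (tens_sum t) = tens_sum (s ++ t).
Proof. by apply/tens_sumP/tr_cat; apply: tens_reprP. Qed.

Fact tens_opp_sum s :
  tens_opp (tens_sum s) = tens_sum [seq (- p.1, p.2) | p <- s].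
Proof. exact/tens_sumP/tens_rel_opp/tens_reprP. Qed.

Fact tens_addA : associative tens_add.
Proof.
move=> x y z; have [[s ->] [t ->] [u ->]] := And3 (tens_ex x) (tens_ex y) (tens_ex z).
by rewrite !tens_add_sum catA.
Qed.

Fact tens_addC : commutative tens_add.
Proof.
move=> x y; have [[s ->] [t ->]] := conj (tens_ex x) (tens_ex y).
by rewrite !tens_add_sum; apply/tens_sumP/tr_catC.
Qed.

Fact tens_add0 : left_id (tens_sum [::]) tens_add.
Proof. by move=> x; have [s ->] := tens_ex x; rewrite tens_add_sum. Qed.

Fact tens_addN : left_inverse (tens_sum [::]) tens_opp tens_add.
Proof.
move=> x; have [s ->] := tens_ex x; rewrite tens_opp_sum.
elim: s => [|[a b] s IHs] /=; first by rewrite tens_add0.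
rewrite -cat1s -[(a, b) :: s]cat1s -!tens_add_sum -tens_addA.
rewrite [X in tens_add _ X]tens_addC -[X in tens_add _ X]tens_addA.
rewrite [X in tens_add _ (tens_add _ X)]tens_addC IHs.
rewrite [X in tens_add _ X]tens_addC tens_add0 tens_add_sum.
apply/tens_sumP; apply: tr_trans (tr_0l b).
by have := tr_addl (- a) a b; rewrite addNr; apply: tr_sym.
Qed.

HB.instance Definition _ :=
  GRing.isZmodule.Build tensor tens_addA tens_addC tens_add0 tens_addN.

Definition pure (a : A) (b : B) : tensor := tens_sum [:: (a, b)].

Lemma tens_sum_cat s t : tens_sum (s ++ t) = tens_sum s + tens_sum t.
Proof. by rewrite -tens_add_sum. Qed.

Lemma tens_sumE s : tens_sum s = \sum_(p <- s) pure p.1 p.2.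
Proof.
elim: s => [|[a b] s IHs]; first by rewrite big_nil.
by rewrite big_cons -cat1s tens_sum_cat IHs.
Qed.

Lemma tens_ind (P : tensor -> Prop) :
  P 0 -> (forall a b x, P x -> P (pure a b + x)) -> forall x, P x.
Proof.
move=> P0 PD x; have [s ->] := tens_ex x; rewrite tens_sumE.
by elim: s => [|p s IHs]; rewrite ?big_nil // big_cons; apply: PD.
Qed.

Lemma pureDl a a' b : pure (a + a') b = pure a b + pure a' b.
Proof. by rewrite -tens_sum_cat; apply/tens_sumP/tr_addl. Qed.

Lemma pureDr a b b' : pure a (b + b') = pure a b + pure a b'.
Proof. by rewrite -tens_sum_cat; apply/tens_sumP/tr_addr. Qed.

Lemma pureZ c a b : pure (c%:k * a) b = pure a (c%:k * b).
Proof. exact/tens_sumP/tr_scal. Qed.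

Definition balanced (V : zmodType) (phi : A -> B -> V) : Prop :=
  [/\ forall a a' b, phi (a + a') b = phi a b + phi a' b,
      forall a b b', phi a (b + b') = phi a b + phi a b'
    & forall (c : k) a b, phi (c%:k * a) b = phi a (c%:k * b)].

Definition tens_lift (V : zmodType) (phi : A -> B -> V) (x : tensor) : V :=
  \sum_(p <- tens_repr x) phi p.1 p.2.

Section Lift.
Variables (V : zmodType) (phi : A -> B -> V).
Hypothesis bphi : balanced phi.

Lemma tens_rel_sum s t : tens_rel s t ->
  \sum_(p <- s) phi p.1 p.2 = \sum_(p <- t) phi p.1 p.2.
Proof.
have [phiDl phiDr phiZ] := bphi.
elim=> {s t}.
- by [].
- by move=> s t _ ->.
- by move=> s t u _ -> _ ->.
- by move=> s s' t t' _ IH _ IH'; rewrite !big_cat IH IH'.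
- by move=> s t; rewrite !big_cat /= addrC.
- by move=> a a' b; rewrite !(big_cons, big_nil) !addr0 phiDl.
- by move=> a b b'; rewrite !(big_cons, big_nil) !addr0 phiDr.
- move=> b; rewrite big_cons !big_nil addr0 /=.
  by apply: (addIr (phi 0 b)); rewrite -phiDl addr0 add0r.
- by move=> c a b; rewrite !(big_cons, big_nil) phiZ.
Qed.

Lemma tens_lift_sum s : tens_lift phi (tens_sum s) = \sum_(p <- s) phi p.1 p.2.
Proof. exact/tens_rel_sum/tens_reprP. Qed.

Lemma tens_lift_pure a b : tens_lift phi (pure a b) = phi a b.
Proof. by rewrite tens_lift_sum big_cons big_nil addr0. Qed.

Lemma tens_lift0 : tens_lift phi 0 = 0.
Proof. by rewrite -[0]/(tens_sum [::]) tens_lift_sum big_nil. Qed.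

Lemma tens_liftD x y : tens_lift phi (x + y) = tens_lift phi x + tens_lift phi y.
Proof.
have [[s ->] [t ->]] := conj (tens_ex x) (tens_ex y).
by rewrite -tens_sum_cat !tens_lift_sum big_cat.
Qed.
End Lift.

Fact balanced_mulr c d : balanced (fun a b => pure (a * c) (b * d)).
Proof.
split=> [a a' b|a b b'|e a b]; first by rewrite mulrDl pureDl.
  by rewrite mulrDl pureDr.
by rewrite -!mulrA pureZ.
Qed.

Definition tens_mul (x y : tensor) : tensor :=
  \sum_(q <- tens_repr y) tens_lift (fun a b => pure (a * q.1) (b * q.2)) x.

Fact tens_mulDl : left_distributive tens_mul +%R.
Proof.
move=> x y z; rewrite /tens_mul -big_split /=.
by apply: eq_bigr => q _; apply: tens_liftD; apply: balanced_mulr.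
Qed.

Fact tens_mul0 y : tens_mul 0 y = 0.
Proof. by rewrite /tens_mul big1 // => q _; apply: tens_lift0; apply: balanced_mulr. Qed.

Fact tens_mul_purel a b y :
  tens_mul (pure a b) y = tens_lift (fun c d => pure (a * c) (b * d)) y.
Proof.
by apply: eq_bigr => q _; rewrite tens_lift_pure //; apply: balanced_mulr.
Qed.

Fact balanced_mull a b : balanced (fun c d => pure (a * c) (b * d)).
Proof.
split=> [c c' d|c d d'|e c d]; first by rewrite mulrDr pureDl.
  by rewrite mulrDr pureDr.
by rewrite ![_ * (e%:k * _)]mulrCA pureZ.
Qed.

Lemma tens_mul_pure a b c d :
  tens_mul (pure a b) (pure c d) = pure (a * c) (b * d).
Proof. by rewrite tens_mul_purel tens_lift_pure //; apply: balanced_mull. Qed.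

Fact tens_mulDr : right_distributive tens_mul +%R.
Proof.
move=> x y z; elim/tens_ind: x => [|a b x IHx]; first by rewrite !tens_mul0 addr0.
rewrite !tens_mulDl IHx !tens_mul_purel tens_liftD; last exact: balanced_mull.
by rewrite addrACA.
Qed.

Fact tens_mulr0 x : tens_mul x 0 = 0.
Proof. by apply: (addIr (tens_mul x 0)); rewrite -tens_mulDr addr0 add0r. Qed.

Fact tens_mulC : commutative tens_mul.
Proof.
move=> x y; elim/tens_ind: x => [|a b x IHx]; first by rewrite tens_mul0 tens_mulr0.
rewrite tens_mulDl tens_mulDr IHx; congr (_ + _).
elim/tens_ind: y {IHx} => [|c d y IHy]; first by rewrite tens_mul0 tens_mulr0.
rewrite tens_mulDl tens_mulDr IHy !tens_mul_pure; congr (pure _ _ + _); exact: mulrC.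
Qed.

Fact tens_mulA : associative tens_mul.
Proof.
move=> x y z; elim/tens_ind: x => [|a b x IHx]; first by rewrite !tens_mul0.
rewrite !tens_mulDl IHx; congr (_ + _); elim/tens_ind: y {IHx} => [|c d y IHy].
  by rewrite !(tens_mul0, tens_mulr0).
rewrite !(tens_mulDl, tens_mulDr) IHy; congr (_ + _); elim/tens_ind: z {IHy} => [|e f z IHz].
  by rewrite !tens_mulr0.
by rewrite !tens_mulDr IHz !tens_mul_pure !mulrA.
Qed.

Fact tens_mul1 : left_id (pure 1 1) tens_mul.
Proof.
elim/tens_ind => [|a b x IHx]; first exact: tens_mulr0.
by rewrite tens_mulDr IHx tens_mul_pure !mul1r.
Qed.

HB.instance Definition _ := GRing.Zmodule_isComPzRing.Build tensor
  tens_mulA tens_mulC tens_mul1 tens_mulDl.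

Lemma pureM a b c d : pure a b * pure c d = pure (a * c) (b * d).
Proof. exact: tens_mul_pure. Qed.

Fact tens_in_zmod : zmod_morphism (fun c : k => pure c%:k 1).
Proof.
move=> c d; apply: (addIr (pure d%:k 1)).
by rewrite -pureDl -rmorphD /= !subrK.
Qed.

Fact tens_in_monoid : monoid_morphism (fun c : k => pure c%:k 1).
Proof. by split=> [|c d]; rewrite ?rmorph1 // pureM mulr1 rmorphM. Qed.

Definition tens_in (c : k) : tensor := pure c%:k 1.
HB.instance Definition _ := GRing.isZmodMorphism.Build k tensor tens_in tens_in_zmod.
HB.instance Definition _ :=
  GRing.isMonoidMorphism.Build k tensor tens_in tens_in_monoid.

Fact balanced_endo j : balanced (fun a b => pure ('s_j a) ('s_j b)).
Proof.
split=> [a a' b|a b b'|c a b]; rewrite ?rmorphD ?pureDl ?pureDr //.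
by rewrite !rmorphM -!sa_inE pureZ.
Qed.

Definition tens_endo (j : 'I_n) : tensor -> tensor :=
  tens_lift (fun a b => pure ('s_j a) ('s_j b)).

Fact tens_endoD j x y : tens_endo j (x + y) = tens_endo j x + tens_endo j y.
Proof. by apply: tens_liftD; apply: balanced_endo. Qed.

Fact tens_endo_pure j a b : tens_endo j (pure a b) = pure ('s_j a) ('s_j b).
Proof. by apply: tens_lift_pure; apply: balanced_endo. Qed.

Fact tens_endo0 j : tens_endo j 0 = 0.
Proof. by apply: tens_lift0; apply: balanced_endo. Qed.

Fact tens_endo_zmod j : zmod_morphism (tens_endo j).
Proof.
by move=> x y; apply: (addIr (tens_endo j y)); rewrite -tens_endoD !subrK.
Qed.

Fact tens_endo_monoid j : monoid_morphism (tens_endo j).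
Proof.
split=> [|x y]; first by rewrite [LHS]tens_endo_pure !rmorph1.
elim/tens_ind: x => [|a b x IHx]; first by rewrite !(mul0r, tens_endo0).
rewrite !(mulrDl, tens_endoD) IHx; congr (_ + _); elim/tens_ind: y {IHx} => [|c d y IHy].
  by rewrite !(mulr0, tens_endo0).
by rewrite !(mulrDr, tens_endoD) IHy !(pureM, tens_endo_pure) !rmorphM.
Qed.

HB.instance Definition _ j :=
  GRing.isZmodMorphism.Build tensor tensor (tens_endo j) (tens_endo_zmod j).
HB.instance Definition _ j :=
  GRing.isMonoidMorphism.Build tensor tensor (tens_endo j) (tens_endo_monoid j).

Fact tens_endoC i j x : tens_endo i (tens_endo j x) = tens_endo j (tens_endo i x).
Proof.
elim/tens_ind: x => [|a b x IHx]; first by rewrite !tens_endo0.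
by rewrite !tens_endoD IHx !tens_endo_pure !(endoC _ i j).
Qed.

Fact tens_in_endo j c :
  tens_in (endo (sf_struct k) j c) = tens_endo j (tens_in c).
Proof. by rewrite tens_endo_pure rmorph1 -sa_inE. Qed.

Definition tensor_alg : sigmaAlgebra k :=
  @SigmaAlgebra n k tensor
    (@SigmaStruct n tensor (fun j => tens_endo j) tens_endoC) tens_in tens_in_endo.

Definition tens_inl (a : A) : tensor := pure a 1.
Definition tens_inr (b : B) : tensor := pure 1 b.

Fact tens_inl_zmod : zmod_morphism tens_inl.
Proof.
by move=> a b; apply: (addIr (tens_inl b)); rewrite /tens_inl -pureDl !subrK.
Qed.

Fact tens_inl_monoid : monoid_morphism tens_inl.
Proof. by split=> // a b; rewrite /tens_inl pureM mulr1. Qed.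

Fact tens_inr_zmod : zmod_morphism tens_inr.
Proof.
by move=> a b; apply: (addIr (tens_inr b)); rewrite /tens_inr -pureDr !subrK.
Qed.

Fact tens_inr_monoid : monoid_morphism tens_inr.
Proof. by split=> // a b; rewrite /tens_inr pureM mulr1. Qed.

HB.instance Definition _ := GRing.isZmodMorphism.Build A tensor tens_inl tens_inl_zmod.
HB.instance Definition _ := GRing.isMonoidMorphism.Build A tensor tens_inl tens_inl_monoid.
HB.instance Definition _ := GRing.isZmodMorphism.Build B tensor tens_inr tens_inr_zmod.
HB.instance Definition _ := GRing.isMonoidMorphism.Build B tensor tens_inr tens_inr_monoid.

Fact tens_inl_sigma j a : tens_inl ('s_j a) = tens_endo j (tens_inl a).
Proof. by rewrite tens_endo_pure rmorph1. Qed.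

Fact tens_inr_sigma j b : tens_inr ('s_j b) = tens_endo j (tens_inr b).
Proof. by rewrite tens_endo_pure rmorph1. Qed.

Fact tens_inr_in c : tens_inr c%:k = tens_in c.
Proof. by have := pureZ c 1 1; rewrite !mulr1. Qed.

Definition inlHom : sigmaHom A tensor_alg :=
  @SigmaHom n k A tensor_alg tens_inl (fun _ => erefl) tens_inl_sigma.
Definition inrHom : sigmaHom B tensor_alg :=
  @SigmaHom n k B tensor_alg tens_inr tens_inr_in tens_inr_sigma.

End Tensor.

Section HopfIdeal.
Variables (n : nat) (k : sigmaField n) (H : sigmaAlgGroup k).
Local Notation A := (coord H).

(* The structure maps correspond to the group law of H under the Yoneda lemma:
   multiplication is (x, y) |-> x * y at the universal pair of points, with
   values in k{H} (x) k{H}; unit and inverse likewise. *)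
Definition comult : sigmaHom A (tensor_alg A A) :=
  ev (pt (inlHom A A) * pt (inrHom A A))%g.
Definition counit : sigmaHom A (base_alg k) := ev (1%g : H (base_alg k)).
Definition antipode : sigmaHom A A := ev (pt (idHom A))^-1%g.

Definition is_ideal (I : A -> Prop) : Prop :=
  [/\ I 0, forall x y, I x -> I y -> I (x + y) & forall a x, I x -> I (a * x)].

(* I (x) k{H} + k{H} (x) I *)
Definition tensor_ideal (I : A -> Prop) (t : tensor_alg A A) : Prop :=
  exists s1 s2 : seq (A * A),
    [/\ forall p, p \in s1 -> I p.1, forall p, p \in s2 -> I p.2
      & t = tens_sum s1 + tens_sum s2].

Definition hopf_ideal (I : A -> Prop) : Prop :=
  [/\ is_ideal I, forall a, I a -> tensor_ideal I (comult a),
      forall a, I a -> counit a = 0 & forall a, I a -> I (antipode a)].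

Definition sigma_hopf_ideal (I : A -> Prop) : Prop :=
  hopf_ideal I /\ forall (j : 'I_n) a, I a -> I ('s_j a).

Definition sigma_closed (S : subgroupFunctor H) : Prop :=
  exists2 I : A -> Prop, sigma_hopf_ideal I &
    forall (R : sigmaAlgebra k) (x : H R),
      x \in sub_mem S R <-> forall a, I a -> ev x a = 0.

End HopfIdeal.

Section GLpoints.
Variables (R : comPzRingType) (s : nat).

Definition invertible : pred 'M[R]_s :=
  fun M => `[< exists N, M *m N = 1%:M /\ N *m M = 1%:M >].

Definition GLtype := {M : 'M[R]_s | invertible M}.
HB.instance Definition _ := SubChoice.on GLtype.
Definition GLmx (M : 'M[R]_s) (uM : invertible M) : GLtype :=
  exist (fun M => invertible M) M uM.

Fact invertible_ex (M : GLtype) :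
  exists N, val M *m N = 1%:M /\ N *m val M = 1%:M.
Proof. exact/asboolP/(valP M). Qed.

Definition inverse (M : GLtype) : 'M[R]_s := sval (cid (invertible_ex M)).

Lemma mulmx_inverse M : val M *m inverse M = 1%:M.
Proof. by rewrite /inverse; case: cid => N []. Qed.

Lemma inverse_mulmx M : inverse M *m val M = 1%:M.
Proof. by rewrite /inverse; case: cid => N []. Qed.

Fact GL_one_subproof : invertible 1%:M.
Proof. by apply/asboolP; exists 1%:M; rewrite mulmx1. Qed.

Fact GL_mul_subproof (M N : GLtype) : invertible (val M *m val N).
Proof.
apply/asboolP; exists (inverse N *m inverse M); split.
  by rewrite mulmxA -(mulmxA (val M)) mulmx_inverse mulmx1 mulmx_inverse.
by rewrite mulmxA -(mulmxA (inverse N)) inverse_mulmx mulmx1 inverse_mulmx.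
Qed.

Fact GL_inv_subproof (M : GLtype) : invertible (inverse M).
Proof. by apply/asboolP; exists (val M); rewrite mulmx_inverse inverse_mulmx. Qed.

Definition GL_one : GLtype := GLmx GL_one_subproof.
Definition GL_mul (M N : GLtype) : GLtype := GLmx (GL_mul_subproof M N).
Definition GL_inv (M : GLtype) : GLtype := GLmx (GL_inv_subproof M).

Fact GL_mulA : associative GL_mul.
Proof. by move=> M N P; apply: val_inj; rewrite /= mulmxA. Qed.
Fact GL_mul1 : left_id GL_one GL_mul.
Proof. by move=> M; apply: val_inj; rewrite /= mul1mx. Qed.
Fact GL_mulr1 : right_id GL_one GL_mul.
Proof. by move=> M; apply: val_inj; rewrite /= mulmx1. Qed.
Fact GL_mulV : left_inverse GL_one GL_inv GL_mul.
Proof. by move=> M; apply: val_inj; rewrite /= inverse_mulmx. Qed.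
Fact GL_mulrV : right_inverse GL_one GL_inv GL_mul.
Proof. by move=> M; apply: val_inj; rewrite /= mulmx_inverse. Qed.

HB.instance Definition _ :=
  isGroup.Build GLtype GL_mulA GL_mul1 GL_mulr1 GL_mulV GL_mulrV.

Lemma inverse_uniq (M : GLtype) N : val M *m N = 1%:M -> inverse M = N.
Proof.
by move=> MN; rewrite -[LHS]mulmx1 -MN mulmxA inverse_mulmx mul1mx.
Qed.

End GLpoints.

Section GLmap.
Variables (R S : comPzRingType) (s : nat) (f : {rmorphism R -> S}).

Fact GL_map_subproof (M : GLtype R s) : invertible (map_mx f (val M)).
Proof.
apply/asboolP; exists (map_mx f (inverse M)).
by rewrite -!map_mxM mulmx_inverse inverse_mulmx map_mx1.
Qed.

Definition GL_map (M : GLtype R s) : GLtype S s := GLmx (GL_map_subproof M).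

Lemma inverse_map M : inverse (GL_map M) = map_mx f (inverse M).
Proof. by apply: inverse_uniq; rewrite /= -map_mxM mulmx_inverse map_mx1. Qed.
End GLmap.

Section GL.
Variables (n : nat) (k : sigmaField n) (s : nat).

Definition GL_obj (R : sigmaAlgebra k) : groupType := GLtype R s.
Definition GL_gf_map (R S : sigmaAlgebra k) (f : sigmaHom R S) :
  GL_obj R -> GL_obj S := GL_map f.

Fact GL_gf_mapM R S (f : sigmaHom R S) (x y : GL_obj R) :
  GL_gf_map f (x * y)%g = (GL_gf_map f x * GL_gf_map f y)%g.
Proof. by apply: val_inj; rewrite /= map_mxM. Qed.

Fact GL_gf_map_id R (x : GL_obj R) : GL_gf_map (idHom R) x = x.
Proof. by apply: val_inj; apply/matrixP=> i j; rewrite mxE. Qed.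

Fact GL_gf_map_comp R S T (g : sigmaHom S T) (f : sigmaHom R S) (x : GL_obj R) :
  GL_gf_map (compHom g f) x = GL_gf_map g (GL_gf_map f x).
Proof. by apply: val_inj; apply/matrixP=> i j; rewrite !mxE. Qed.

Definition GL_functor : groupFunctor k :=
  @GroupFunctor n k GL_obj GL_gf_map GL_gf_mapM GL_gf_map_id GL_gf_map_comp.

(* k{GL_s} as the algebra of difference-polynomial expressions in the entries
   of a generic invertible matrix ([GVar false]) and of its inverse
   ([GVar true]), two expressions being identified when they agree at all
   points of GL_s. *)
Inductive GLexpr :=
| GCst of k
| GVar of bool & 'I_s & 'I_s
| GAdd of GLexpr & GLexpr
| GMul of GLexpr & GLexpr
| GSig of 'I_n & GLexpr.

HB.instance Definition _ := gen_eqMixin GLexpr.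
HB.instance Definition _ := gen_choiceMixin GLexpr.

Fixpoint GLeval (R : sigmaAlgebra k) (M : GL_obj R) (e : GLexpr) : R :=
  match e with
  | GCst c => c%:k
  | GVar b i j => (if b then inverse M else val M) i j
  | GAdd e1 e2 => GLeval M e1 + GLeval M e2
  | GMul e1 e2 => GLeval M e1 * GLeval M e2
  | GSig j e1 => 's_j (GLeval M e1)
  end.

Definition GLrel : rel GLexpr := fun e1 e2 =>
  `[< forall (R : sigmaAlgebra k) (M : GL_obj R), GLeval M e1 = GLeval M e2 >].

Fact GLrel_refl : reflexive GLrel.
Proof. by move=> e; apply/asboolP. Qed.
Fact GLrel_sym : symmetric GLrel.
Proof. by move=> e1 e2; apply/asboolP/asboolP=> E R M; rewrite E. Qed.
Fact GLrel_trans : transitive GLrel.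
Proof.
by move=> e2 e1 e3 /asboolP E /asboolP E'; apply/asboolP=> R M; rewrite E.
Qed.

Canonical GLequiv := EquivRel GLrel GLrel_refl GLrel_sym GLrel_trans.
Definition GLcoord := {eq_quot GLequiv}.
HB.instance Definition _ := Choice.on GLcoord.

Definition GLcls (e : GLexpr) : GLcoord := \pi_({eq_quot GLequiv}) e.
Definition GLval (R : sigmaAlgebra k) (M : GL_obj R) (x : GLcoord) : R :=
  GLeval M (repr x).

Lemma GLval_cls R (M : GL_obj R) e : GLval M (GLcls e) = GLeval M e.
Proof.
have /eqmodP/asboolP := reprK (GLcls e); exact.
Qed.

Lemma GLcoord_ext (x y : GLcoord) :
  (forall R (M : GL_obj R), GLval M x = GLval M y) -> x = y.
Proof.
by move=> E; rewrite -[x]reprK -[y]reprK; apply/eqmodP/asboolP.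
Qed.

Definition GLc0 := GLcls (GCst 0).
Definition GLc1 := GLcls (GCst 1).
Definition GLcD (x y : GLcoord) := GLcls (GAdd (repr x) (repr y)).
Definition GLcM (x y : GLcoord) := GLcls (GMul (repr x) (repr y)).
Definition GLcN (x : GLcoord) := GLcls (GMul (GCst (-1)) (repr x)).

Definition GLcS j (x : GLcoord) := GLcls (GSig j (repr x)).
Definition GLcin (c : k) := GLcls (GCst c).

Section Values.
Variables (R : sigmaAlgebra k) (M : GL_obj R).

Fact GLval0 : GLval M GLc0 = 0. Proof. by rewrite GLval_cls /= rmorph0. Qed.
Fact GLval1 : GLval M GLc1 = 1. Proof. by rewrite GLval_cls /= rmorph1. Qed.
Fact GLvalD x y : GLval M (GLcD x y) = GLval M x + GLval M y.
Proof. exact: GLval_cls. Qed.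
Fact GLvalM x y : GLval M (GLcM x y) = GLval M x * GLval M y.
Proof. exact: GLval_cls. Qed.
Fact GLvalN x : GLval M (GLcN x) = - GLval M x.
Proof. by rewrite GLval_cls /= rmorphN1 mulN1r. Qed.
Fact GLvalS j x : GLval M (GLcS j x) = 's_j (GLval M x).
Proof. exact: GLval_cls. Qed.
Fact GLval_in c : GLval M (GLcin c) = c%:k.
Proof. exact: GLval_cls. Qed.
End Values.
Definition GLvalE := (GLval0, GLval1, GLvalD, GLvalM, GLvalN, GLvalS, GLval_in).

Fact GLcDA : associative GLcD.
Proof. by move=> x y z; apply: GLcoord_ext => R M; rewrite !GLvalE addrA. Qed.
Fact GLcDC : commutative GLcD.
Proof. by move=> x y; apply: GLcoord_ext => R M; rewrite !GLvalE addrC. Qed.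
Fact GLcD0 : left_id GLc0 GLcD.
Proof. by move=> x; apply: GLcoord_ext => R M; rewrite !GLvalE add0r. Qed.
Fact GLcDN : left_inverse GLc0 GLcN GLcD.
Proof. by move=> x; apply: GLcoord_ext => R M; rewrite !GLvalE addNr. Qed.
Fact GLcMA : associative GLcM.
Proof. by move=> x y z; apply: GLcoord_ext => R M; rewrite !GLvalE mulrA. Qed.
Fact GLcMC : commutative GLcM.
Proof. by move=> x y; apply: GLcoord_ext => R M; rewrite !GLvalE mulrC. Qed.
Fact GLcM1 : left_id GLc1 GLcM.
Proof. by move=> x; apply: GLcoord_ext => R M; rewrite !GLvalE mul1r. Qed.
Fact GLcMD : left_distributive GLcM GLcD.
Proof. by move=> x y z; apply: GLcoord_ext => R M; rewrite !GLvalE mulrDl. Qed.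

HB.instance Definition _ := GRing.isZmodule.Build GLcoord GLcDA GLcDC GLcD0 GLcDN.
HB.instance Definition _ :=
  GRing.Zmodule_isComPzRing.Build GLcoord GLcMA GLcMC GLcM1 GLcMD.

Fact GLcS_zmod j : zmod_morphism (GLcS j).
Proof.
move=> x y; apply: GLcoord_ext => R M; rewrite GLvalS.
by rewrite [GLval M (x - y)](GLvalD M) [RHS](GLvalD M) !GLvalN !GLvalS rmorphB.
Qed.
Fact GLcS_monoid j : monoid_morphism (GLcS j).
Proof.
split=> [|x y]; apply: GLcoord_ext => R M.
  by rewrite GLvalS [GLval M 1](GLval1 M) rmorph1.
by rewrite [RHS](GLvalM M) !GLvalS [GLval M (x * y)](GLvalM M) rmorphM.
Qed.
Fact GLcin_zmod : zmod_morphism GLcin.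
Proof.
move=> x y; apply: GLcoord_ext => R M.
by rewrite [RHS](GLvalD M) GLvalN !GLvalE rmorphB.
Qed.
Fact GLcin_monoid : monoid_morphism GLcin.
Proof.
split=> [|x y]; apply: GLcoord_ext => R M; first exact: erefl.
by rewrite [RHS](GLvalM M) !GLvalE rmorphM.
Qed.

HB.instance Definition _ j :=
  GRing.isZmodMorphism.Build GLcoord GLcoord (GLcS j) (GLcS_zmod j).
HB.instance Definition _ j :=
  GRing.isMonoidMorphism.Build GLcoord GLcoord (GLcS j) (GLcS_monoid j).
HB.instance Definition _ := GRing.isZmodMorphism.Build k GLcoord GLcin GLcin_zmod.
HB.instance Definition _ :=
  GRing.isMonoidMorphism.Build k GLcoord GLcin GLcin_monoid.

Fact GLcSC i j x : GLcS i (GLcS j x) = GLcS j (GLcS i x).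
Proof. by apply: GLcoord_ext => R M; rewrite !GLvalS endoC. Qed.

Fact GLcin_endo j c : GLcin (endo (sf_struct k) j c) = GLcS j (GLcin c).
Proof. by apply: GLcoord_ext => R M; rewrite !GLvalE sa_inE. Qed.

Definition GLalg : sigmaAlgebra k :=
  @SigmaAlgebra n k GLcoord
    (@SigmaStruct n GLcoord (fun j => GLcS j) GLcSC) GLcin GLcin_endo.

Definition GLvar b i j : GLalg := GLcls (GVar b i j).

Fact GLalg_fg : finitely_sigma_generated GLalg.
Proof.
exists [seq GLvar p.1 p.2.1 p.2.2 | p : bool * ('I_s * 'I_s)] => P [Pc PD PM] Pw x.
suffices PwE e w : P (sigma_word (w : seq 'I_n) (GLcls e : GLalg)).
  by have := PwE (repr x) [::]; rewrite /= /GLcls reprK.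
have wS v (a : GLalg) i : sigma_word v ('s_i a) = sigma_word (rcons v i) a.
  by rewrite /sigma_word -cats1 foldr_cat.
have wD v (a b : GLalg) : sigma_word v (a + b) = sigma_word v a + sigma_word v b.
  by elim: v => //= j v ->; rewrite rmorphD.
have wM v (a b : GLalg) : sigma_word v (a * b) = sigma_word v a * sigma_word v b.
  by elim: v => //= j v ->; rewrite rmorphM.
have clsE (f g : GLexpr) : GLrel f g -> GLcls f = GLcls g by move=> fg; apply/eqmodP.
have reprE (f : GLexpr) R (M : GL_obj R) : GLeval M (repr (GLcls f)) = GLeval M f.
  exact: GLval_cls.
elim: e w => [c|b i j|e1 IH1 e2 IH2|e1 IH1 e2 IH2|j e IHe] w.
- suffices [d ->] : exists d, sigma_word w (GLcls (GCst c) : GLalg) = d%:k by [].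
  elim: w => [|j w [d dE]]; first by exists c.
  by exists (endo (sf_struct k) j d); rewrite sa_inE -dE.
- by apply: Pw; apply/mapP; exists (b, (i, j)); rewrite ?mem_enum.
- rewrite (_ : GLcls _ = (GLcls e1 : GLalg) + (GLcls e2 : GLalg)).
    by rewrite wD; apply: PD.
  by apply: clsE; apply/asboolP=> R M; rewrite /= !reprE.
- rewrite (_ : GLcls _ = (GLcls e1 : GLalg) * (GLcls e2 : GLalg)).
    by rewrite wM; apply: PM.
  by apply: clsE; apply/asboolP=> R M; rewrite /= !reprE.
- rewrite (_ : GLcls _ = 's_j (GLcls e : GLalg)); first by rewrite wS.
  by apply: clsE; apply/asboolP=> R M; rewrite /= !reprE.
Qed.

Section Evaluation.
Variables (R : sigmaAlgebra k) (M : GL_obj R).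

Definition GLev_fun (x : GLalg) : R := GLval M x.

Fact GLev_zmod : zmod_morphism GLev_fun.
Proof. by move=> x y; rewrite /GLev_fun [LHS](GLvalD M) GLvalN. Qed.
Fact GLev_monoid : monoid_morphism GLev_fun.
Proof. by split=> [|x y]; [exact: GLval1 | exact: GLvalM]. Qed.

HB.instance Definition _ := GRing.isZmodMorphism.Build GLalg R GLev_fun GLev_zmod.
HB.instance Definition _ :=
  GRing.isMonoidMorphism.Build GLalg R GLev_fun GLev_monoid.

Fact GLev_in c : GLev_fun c%:k = c%:k. Proof. exact: GLval_in. Qed.
Fact GLev_sigma j a : GLev_fun ('s_j a) = 's_j (GLev_fun a).
Proof. exact: GLvalS. Qed.

Definition GLev : sigmaHom GLalg R := SigmaHom GLev_in GLev_sigma.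
End Evaluation.

Definition GLgen b : 'M[GLalg]_s := \matrix_(i, j) GLvar b i j.

Lemma GLval_sum (R : sigmaAlgebra k) (M : GL_obj R) I (r : seq I) (F : I -> GLalg) :
  GLval M (\sum_(i <- r) F i) = \sum_(i <- r) GLval M (F i).
Proof. exact: (rmorph_sum (GLev M)). Qed.

Lemma map_GLev_gen (R : sigmaAlgebra k) (M : GL_obj R) b :
  map_mx (GLev M) (GLgen b) = if b then inverse M else val M.
Proof. by apply/matrixP=> i j; rewrite !mxE /= /GLev_fun GLval_cls; case: b. Qed.

Lemma GLgenV : GLgen false *m GLgen true = 1%:M.
Proof.
apply/matrixP=> i j; apply: GLcoord_ext => R M.
have E : map_mx (GLev M) (GLgen false *m GLgen true) = map_mx (GLev M) 1%:M.
  by rewrite map_mxM !map_GLev_gen mulmx_inverse map_mx1.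
by move/matrixP/(_ i j): E; rewrite !mxE.
Qed.

Lemma GLgenVl : GLgen true *m GLgen false = 1%:M.
Proof.
apply/matrixP=> i j; apply: GLcoord_ext => R M.
have E : map_mx (GLev M) (GLgen true *m GLgen false) = map_mx (GLev M) 1%:M.
  by rewrite map_mxM !map_GLev_gen inverse_mulmx map_mx1.
by move/matrixP/(_ i j): E; rewrite !mxE.
Qed.

Fact GLgeneric_subproof : invertible (GLgen false).
Proof. by apply/asboolP; exists (GLgen true); rewrite GLgenV GLgenVl. Qed.

Definition GLgeneric : GL_obj GLalg := GLmx GLgeneric_subproof.

Definition GLpt (R : sigmaAlgebra k) (f : sigmaHom GLalg R) : GL_obj R :=
  GL_gf_map f GLgeneric.

Fact GLevK (R : sigmaAlgebra k) (M : GL_obj R) : GLpt (GLev M) = M.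
Proof. by apply: val_inj; rewrite /= map_GLev_gen. Qed.

Fact GLptK (R : sigmaAlgebra k) (f : sigmaHom GLalg R) a : GLev (GLpt f) a = f a.
Proof.
rewrite /= /GLev_fun -[a]reprK -/(GLcls _) GLval_cls.
have inE (f1 f2 : GLexpr) : GLrel f1 f2 -> GLcls f1 = GLcls f2 by move=> ?; apply/eqmodP.
have reprE (e : GLexpr) S (M : GL_obj S) : GLeval M (repr (GLcls e)) = GLeval M e.
  exact: GLval_cls.
elim: (repr a) => [c|b i j|e1 IH1 e2 IH2|e1 IH1 e2 IH2|j e IHe].
- by rewrite /= -(sh_in f).
- rewrite /GLpt [LHS]/= inverse_map.
  rewrite (inverse_uniq (M := GLgeneric) GLgenV) /=.
  by case: b; rewrite !mxE.
- rewrite [LHS]/= IH1 IH2 -rmorphD; congr (f _).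
  by apply: inE; apply/asboolP=> S M; rewrite /= !reprE.
- rewrite [LHS]/= IH1 IH2 -rmorphM; congr (f _).
  by apply: inE; apply/asboolP=> S M; rewrite /= !reprE.
- rewrite [LHS]/= IHe -[LHS](sh_sigma f j (GLcls e : GLalg)); congr (f _).
  by apply: inE; apply/asboolP=> S M; rewrite /= !reprE.
Qed.

Fact GLev_natural (R S : sigmaAlgebra k) (f : sigmaHom R S) (M : GL_obj R) a :
  GLev (GL_gf_map f M) a = f (GLev M a).
Proof.
rewrite /= /GLev_fun /GLval; elim: (repr a) => [c|b i j|e1 IH1 e2 IH2|e1 IH1 e2 IH2|j e IHe] /=.
- by rewrite sh_in.
- by rewrite inverse_map; case: b; rewrite !mxE.
- by rewrite IH1 IH2 rmorphD.
- by rewrite IH1 IH2 rmorphM.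
- by rewrite IHe sh_sigma.
Qed.

Definition GL : sigmaAlgGroup k :=
  @SigmaAlgGroup n k GL_functor GLalg GLalg_fg GLev GLpt GLevK GLptK GLev_natural.

End GL.

(* Main.v *)
From HB Require Import structures.
Require Import Defs.
From mathcomp Require Import all_boot all_algebra.
From mathcomp Require Import boolp classical_sets.

(** Write A for k{G}. Comultiplication sends a in A to a finite sum of p_i (x)
q_i, and when that sum has as few terms as possible, both the p_i and the q_i are
linearly independent over k. Then the span of the p_i is stable under the right
translations of G: expanding the value of a at x * y * z in the two ways allowed
by associativity, and comparing the coefficients of the q_i, gives
  p_j (x * y) = \sum_i p_i (x) * M i j (y)
for some matrix M over A. A second use of associativity, now comparing the
coefficients of the p_i, shows that M (y * z) = M (y) *m M (z) and M (1) = 1,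
so M is a linear representation of G; and a lies in the algebra generated by its
entries, because a (x) = a (1 * x * 1). This is [ex_comatrix]. A block-diagonal
sum over the finitely many sigma-generators of A then provides one representation
rho : G -> GL_s whose comorphism k{GL_s} -> A is surjective
([comorphism_rep_surj]). As the comorphism commutes with every sigma_j, its image
contains the translates of the generators along with the generators, so M need
only account for the generators themselves.

It remains to see that a morphism rho : G -> H with surjective comorphism phi is
a closed embedding ([closed_embedding]). The ideal is I = ker phi. It is a Hopf
ideal because phi commutes with the structure maps and because ker (phi (x) phi)
is I (x) k{H} + k{H} (x) I for surjective phi ([tensor_hom_kernel]). A point of H
killing I factors through phi, hence comes from G, and from a single point of G
since phi is surjective.

Coefficients with respect to independent families are read off with dual linear
forms ([dual_functionals]); as A has infinite dimension in general, these
are obtained from Zorn's lemma. *)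

Set Implicit Arguments.
Unset Strict Implicit.
Unset Printing Implicit Defensive.

Import GRing.Theory.
Local Open Scope ring_scope.

(** * Linear forms and sums of bilinear terms over a field *)

Section LinearAlgebra.
Variable F : fieldType.

Definition subspace (V : lmodType F) (W : set V) : Prop :=
  W 0 /\ forall c x y, W x -> W y -> W (c *: x + y).

(** By Zorn's lemma there is a maximal X such that the union U of W and X is a
subspace missing q. By maximality U is a hyperplane complementary to the line of q, and the form is the
coordinate along q. *)
Lemma separating_functional (V : lmodType F) (W : set V) (q : V) :
  subspace W -> ~ W q ->
  exists f : V -> F, [/\ scalar f, forall x, W x -> f x = 0 & f q = 1].
Proof.
move=> subW Wq.
(* The predicate concerns W `|` X rather than X, so that it holds for the union
   of the empty chain. *)
pose P (X : set V) := subspace (W `|` X)%classic /\ ~ (W `|` X)%classic q.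
have [C CP totC|X [[subU Uq] maxX]] := @Zorn_bigcup V P.
  have inU X x : C X -> (W `|` X)%classic x ->
    (W `|` \bigcup_(Y in C) Y)%classic x.
    by move=> CX [Wx|Xx]; [left | right; exists X].
  have outU x y : (W `|` \bigcup_(Y in C) Y)%classic x ->
      (W `|` \bigcup_(Y in C) Y)%classic y ->
      W x /\ W y \/ exists X, [/\ C X, (W `|` X)%classic x & (W `|` X)%classic y].
    case=> [Wx|[X CX Xx]] [Wy|[Y CY Yy]].
    - by left.
    - by right; exists Y; split=> //; [left | right].
    - by right; exists X; split=> //; [right | left].
    - have [XY|YX] := totC _ _ CX CY; right.
        by exists Y; split=> //; right=> //; apply: XY.
      by exists X; split=> //; right=> //; apply: YX.
  split; first split.
  - by left; case: subW.
  - move=> c x y Ux Uy; case: (outU _ _ Ux Uy) => [[Wx Wy]|[X [CX Xx Xy]]].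
      by left; apply: subW.2.
    by apply: (inU X) => //; apply: (CP _ CX).1.2.
  - move=> Uq; case: (outU _ _ Uq Uq) => [[//]|[X [CX Xx _]]].
    exact: (CP _ CX).2.
pose U := (W `|` X)%classic.
have UZ c x : U x -> U (c *: x).
  by move=> Ux; rewrite -[_ *: _]addr0; apply: subU.2 => //; apply: subU.1.
(* Otherwise U + kx would be larger than U and still miss q. *)
have exc x : exists c, U (x - c *: q).
  have [Ux|Ux] := pselect (U x); first by exists 0; rewrite scale0r subr0.
  pose B : set V := [set y | exists c, U (y - c *: x)]%classic.
  have UB : (U `<=` B)%classic by move=> u Uu; exists 0; rewrite scale0r subr0.
  have WB : (W `|` B)%classic = B.
    by apply/seteqP; split=> y; [case=> // Wy; apply: UB; left | right].
  have /not_andP[] : ~ P B.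
  - apply: maxX; split; last first.
      move=> /(_ x) BX; apply: Ux; right; apply: BX.
      by exists 1; rewrite scale1r subrr; apply: subU.1.
    by move=> y Xy; apply: UB; right.
  - rewrite WB => - []; split; first by apply: UB; apply: subU.1.
    move=> c y z [d Ud] [e Ue]; exists (c * d + e).
    have -> : c *: y + z - (c * d + e) *: x = c *: (y - d *: x) + (z - e *: x).
      by rewrite scalerDl scalerBr scalerA opprD addrACA.
    exact: subU.2.
  - rewrite WB => /contrapT[c Uc].
    have c0 : c != 0 by apply: contraPneq Uc => ->; rewrite scale0r subr0.
    exists c^-1; have := UZ (- c^-1) _ Uc.
    by rewrite scalerBr scalerA mulNr mulVf // !scaleNr scale1r opprK addrC.
have uniqc x c d : U (x - c *: q) -> U (x - d *: q) -> c = d.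
  move=> Uc Ud; apply/eqP; rewrite -subr_eq0; apply: contrapT => /negP cd.
  apply: Uq; rewrite -/U -[q]scale1r -(mulVf cd) -scalerA; apply: UZ.
  have := subU.2 (-1) _ _ Uc Ud.
  by rewrite scaleN1r opprB addrA subrK scalerBl.
have fP x := cid (exc x); exists (fun x => sval (fP x)); split.
- move=> c x y; apply: (uniqc (c *: x + y)); first exact: (svalP (fP _)).
  rewrite scalerDl -scalerA opprD addrACA -scalerBr.
  by apply: subU.2; apply: (svalP (fP _)).
- move=> x Wx; apply: (uniqc x); first exact: (svalP (fP _)).
  by rewrite scale0r subr0; left.
- apply: (uniqc q); first exact: (svalP (fP _)).
  by rewrite scale1r subrr; apply: subU.1.
Qed.

Definition lin_indep (V : lmodType F) r (v : 'I_r -> V) : Prop :=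
  forall c : 'I_r -> F, \sum_i c i *: v i = 0 -> forall i, c i = 0.

Lemma dual_functionals (V : lmodType F) r (v : 'I_r -> V) : lin_indep v ->
  exists2 f : 'I_r -> V -> F,
    forall i, scalar (f i) & forall i j, f i (v j) = (i == j)%:R.
Proof.
move=> indv.
suffices /choice[f fP] : forall i, exists f : V -> F,
    scalar f /\ forall j, f (v j) = (i == j)%:R.
  by exists f => i; case: (fP i).
move=> i; pose W : set V := [set x | exists2 c : 'I_r -> F,
  c i = 0 & x = \sum_j c j *: v j]%classic.
have [||f [flin fW fi]] := @separating_functional V W (v i).
- split; first by exists (fun=> 0) => //; rewrite big1 // => j _; rewrite scale0r.
  move=> a _ _ [c ci ->] [d di ->]; exists (fun j => a * c j + d j).
    by rewrite ci di mulr0 addr0.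
  rewrite scaler_sumr -big_split; apply: eq_bigr => j _.
  by rewrite scalerDl scalerA.
- case=> c ci vE.
  have /indv/(_ i)/eqP : \sum_j (c j - (j == i)%:R) *: v j = 0.
    under eq_bigr do rewrite scalerBl; rewrite sumrB -vE.
    rewrite (bigD1 i) //= eqxx scale1r big1 ?addr0 ?subrr // => j /negPf->.
    by rewrite scale0r.
  by rewrite ci eqxx sub0r oppr_eq0 oner_eq0.
exists f; split=> // j; have [<-//|ij] := eqVneq i j; apply: fW.
exists (fun l => (l == j)%:R); first by rewrite (negPf ij).
by rewrite (bigD1 j) //= eqxx scale1r big1 ?addr0 // => l /negPf->; rewrite scale0r.
Qed.

(** A linear relation between the p i lets one of them be eliminated, its term
being spread over the others. Stating this for any balanced biadditive beta
makes it applicable to relations on either side of a tensor. *)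
Lemma shorten_sum (V W : lmodType F) (Z : zmodType) (beta : V -> W -> Z) r
    (p : 'I_r.+1 -> V) (q : 'I_r.+1 -> W) (c : 'I_r.+1 -> F) i0 :
  (forall v v' w, beta (v + v') w = beta v w + beta v' w) ->
  (forall v w w', beta v (w + w') = beta v w + beta v w') ->
  (forall a v w, beta (a *: v) w = beta v (a *: w)) ->
  c i0 != 0 -> \sum_i c i *: p i = 0 ->
  exists (p' : 'I_r -> V) (q' : 'I_r -> W),
    \sum_i beta (p i) (q i) = \sum_i beta (p' i) (q' i).
Proof.
move=> betaDl betaDr betaZ ci0 pc; pose d j := - (c i0)^-1 * c (lift i0 j).
have beta0 w : beta 0 w = 0 by apply: (addrI (beta 0 w)); rewrite -betaDl !addr0.
have pi0 : p i0 = \sum_j d j *: p (lift i0 j).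
  move: pc; rewrite (bigD1_ord i0) //= => /eqP; rewrite addr_eq0 => /eqP pE.
  have -> : p i0 = (c i0)^-1 *: (c i0 *: p i0) by rewrite scalerA mulVf ?scale1r.
  rewrite pE scalerN -scaleNr scaler_sumr.
  by apply: eq_bigr => j _; rewrite scalerA.
exists (fun j => p (lift i0 j)), (fun j => q (lift i0 j) + d j *: q i0).
rewrite (bigD1_ord i0) //= {1}pi0.
have -> : beta (\sum_j d j *: p (lift i0 j)) (q i0) =
    \sum_j beta (d j *: p (lift i0 j)) (q i0).
  exact: (big_morph (beta^~ (q i0)) (fun _ _ => betaDl _ _ _) (beta0 _)).
rewrite -big_split; apply: eq_bigr => j _.
by rewrite betaDr betaZ addrC.
Qed.

Lemma minimal_tensor (V W : lmodType F) (Z : zmodType) (beta : V -> W -> Z)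
    (s : seq (V * W)) :
  (forall v v' w, beta (v + v') w = beta v w + beta v' w) ->
  (forall v w w', beta v (w + w') = beta v w + beta v w') ->
  (forall a v w, beta (a *: v) w = beta v (a *: w)) ->
  exists r (p : 'I_r -> V) (q : 'I_r -> W), [/\ lin_indep p, lin_indep q &
    \sum_(u <- s) beta u.1 u.2 = \sum_i beta (p i) (q i)].
Proof.
move=> betaDl betaDr betaZ; pose t := \sum_(u <- s) beta u.1 u.2; rewrite -/t.
pose P r := `[< exists (p : 'I_r -> V) (q : 'I_r -> W),
  t = \sum_i beta (p i) (q i) >].
have exP : exists r, P r.
  exists (size s); apply/asboolP.
  exists (fun i => (tnth (in_tuple s) i).1), (fun i => (tnth (in_tuple s) i).2).
  by rewrite /t big_tnth.
case: (ex_minnP exP) => r /asboolP[p [q tE]] minr; exists r, p, q.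
suffices sho c : \sum_i c i *: p i = 0 \/ \sum_i c i *: q i = 0 -> forall i, c i = 0.
  by split=> // c cE; apply: sho; [left | right].
move=> cE i; apply/eqP; apply: contrapT => /negP ci.
case: r p q tE minr c cE i ci => [p q _ _ c _ []//|r p q tE minr c cE i ci].
suffices /minr : P r by rewrite ltnn.
apply/asboolP; rewrite tE; case: cE => cE;
  first exact: (shorten_sum _ betaDl betaDr betaZ ci cE).
have [|||q' [p' qpE]] := @shorten_sum W V Z (fun w v => beta v w) r q p c i _ _ _ ci cE.
- by move=> *; apply: betaDr.
- by move=> *; apply: betaDl.
- by move=> *; rewrite betaZ.
by exists p', q'.
Qed.

End LinearAlgebra.

(** * Scalars, tensor products and homomorphisms of k-sigma-algebras *)

(** A type of its own to carry the k-module structure induced by the structure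
morphism of A. *)
Definition lin_space (n : nat) (k : sigmaField n) (A : sigmaAlgebra k) : Type := A.

Section LinSpace.
Variables (n : nat) (k : sigmaField n) (A : sigmaAlgebra k).

HB.instance Definition _ := GRing.Zmodule.copy (lin_space A) A.

Let scale (c : k) (a : lin_space A) : lin_space A := c%:k * (a : A).

Fact lin_spaceA b c a : scale b (scale c a) = scale (b * c) a.
Proof. by rewrite /scale rmorphM mulrA. Qed.
Fact lin_space1 : left_id 1 scale.
Proof. by move=> a; rewrite /scale rmorph1 mul1r. Qed.
Fact lin_spaceDr : right_distributive scale +%R.
Proof. by move=> c a b; apply: mulrDr. Qed.
Fact lin_spaceDl a : {morph scale^~ a : b c / b + c}.
Proof. by move=> b c; rewrite /scale rmorphD mulrDl. Qed.

HB.instance Definition _ := GRing.Zmodule_isLmodule.Build k (lin_space A)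
  lin_spaceA lin_space1 lin_spaceDr lin_spaceDl.
End LinSpace.

Section Homomorphisms.
Variables (n : nat) (k : sigmaField n).
Implicit Types A B R : sigmaAlgebra k.

Lemma sigmaHom_ext A B (f g : sigmaHom A B) : f =1 g -> f = g.
Proof.
case: f g => [f fin fS] [g gin gS] /= fg.
have E : f = g.
  case: f g fg {fin fS gin gS} => [f [[fN] [fM]]] [g [[gN] [gM]]] /= /funext fg.
  case: g / fg gN gM => gN gM.
  by rewrite (Prop_irrelevance gN fN) (Prop_irrelevance gM fM).
case: g / E gin gS {fg} => gin gS.
by rewrite (Prop_irrelevance gin fin) (Prop_irrelevance gS fS).
Qed.

Section Pairing.
Variables (A B R : sigmaAlgebra k) (f : sigmaHom A R) (g : sigmaHom B R).

Let phi (a : A) (b : B) : R := f a * g b.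

Fact balanced_pairing : balanced phi.
Proof.
split=> *; rewrite /phi; first by rewrite rmorphD mulrDl.
  by rewrite rmorphD mulrDr.
by rewrite !rmorphM !sh_in mulrCA mulrA.
Qed.

Definition pairing_fun : tensor_alg A B -> R := tens_lift phi.

Lemma pairing_pure a b : pairing_fun (pure a b) = f a * g b.
Proof. exact/tens_lift_pure/balanced_pairing. Qed.

Let pairingD x y : pairing_fun (x + y) = pairing_fun x + pairing_fun y.
Proof. exact/tens_liftD/balanced_pairing. Qed.

Let pairing0 : pairing_fun 0 = 0.
Proof. exact/tens_lift0/balanced_pairing. Qed.

Fact pairing_zmod : zmod_morphism pairing_fun.
Proof. by move=> x y; apply: (addIr (pairing_fun y)); rewrite -pairingD !subrK. Qed.

Fact pairing_monoid : monoid_morphism pairing_fun.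
Proof.
split=> [|x y]; first by rewrite [LHS]pairing_pure !rmorph1 mulr1.
elim/tens_ind: x => [|a b x IHx]; first by rewrite mul0r pairing0 mul0r.
rewrite mulrDl !pairingD mulrDl IHx; congr (_ + _).
elim/tens_ind: y {IHx} => [|c d y IHy]; first by rewrite mulr0 pairing0 mulr0.
rewrite mulrDr !pairingD mulrDr IHy; congr (_ + _).
by rewrite pureM !pairing_pure !rmorphM mulrACA.
Qed.

HB.instance Definition _ :=
  GRing.isZmodMorphism.Build (tensor_alg A B) R pairing_fun pairing_zmod.
HB.instance Definition _ :=
  GRing.isMonoidMorphism.Build (tensor_alg A B) R pairing_fun pairing_monoid.

Fact pairing_in c : pairing_fun c%:k = c%:k.
Proof. by rewrite [LHS]pairing_pure sh_in rmorph1 mulr1. Qed.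

Fact pairing_sigma j t : pairing_fun ('s_j t) = 's_j (pairing_fun t).
Proof.
elim/tens_ind: t => [|a b t IHt]; first by rewrite !rmorph0.
rewrite (raddfD ('s_j)) pairingD IHt pairingD (raddfD ('s_j)); congr (_ + _).
rewrite [X in pairing_fun X]tens_endo_pure !pairing_pure !sh_sigma.
by symmetry; apply: (rmorphM ('s_j)).
Qed.

(** The universal property of A (x) B as a coproduct of k-sigma-algebras. *)
Definition pairing : sigmaHom (tensor_alg A B) R :=
  SigmaHom pairing_in pairing_sigma.

Lemma pairing_inl : compHom pairing (inlHom A B) = f.
Proof. by apply: sigmaHom_ext => a; rewrite [LHS]pairing_pure rmorph1 mulr1. Qed.

Lemma pairing_inr : compHom pairing (inrHom A B) = g.
Proof. by apply: sigmaHom_ext => b; rewrite [LHS]pairing_pure rmorph1 mul1r. Qed.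

End Pairing.

(** The R-linear map f (x) id : A (x) R -> R; it extracts coefficients. *)
Definition contract A R (f : A -> k) : tensor_alg A R -> R :=
  tens_lift (fun a r => (f a)%:k * r).

Section Contract.
Variables (A R : sigmaAlgebra k) (f : lin_space A -> k).
Hypothesis flin : scalar f.

Fact balanced_contract :
  @balanced n k A R R (fun a r => (f a)%:k * r).
Proof.
have fD a b : f (a + b) = f a + f b by have := flin 1 a b; rewrite scale1r mul1r.
have f0 : f 0 = 0 by apply: (addrI (f 0)); rewrite -fD !addr0.
have fZ c a : f (c *: a) = c * f a by rewrite -[c *: a]addr0 flin f0 addr0.
split=> [a a' r|a r r'|c a r]; first by rewrite fD rmorphD mulrDl.
  exact: mulrDr.
by rewrite fZ rmorphM mulrAC mulrC.
Qed.

Lemma contract_pure a (r : R) : contract f (pure a r) = (f a)%:k * r.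
Proof. exact/tens_lift_pure/balanced_contract. Qed.

Lemma contract_sum I (s : seq I) (t : I -> tensor_alg A R) :
  contract f (\sum_(i <- s) t i) = \sum_(i <- s) contract f (t i).
Proof.
apply: (big_morph (contract f)); last exact/tens_lift0/balanced_contract.
by move=> x y; apply/tens_liftD/balanced_contract.
Qed.
End Contract.

(** The form dual to p i, extended to A (x) R, sends the sum to its coefficient
at i. *)
Lemma lin_indep_tensor A R r (p : 'I_r -> A) (c d : 'I_r -> R) :
  lin_indep (p : _ -> lin_space A) ->
  \sum_i pure (p i) (c i) = \sum_i pure (p i) (d i) -> c =1 d.
Proof.
move=> indp pcd i; have [f flin fp] := dual_functionals indp.
have sumE (e : 'I_r -> R) : contract (f i) (\sum_j pure (p j) (e j)) = e i.
  rewrite contract_sum //; under eq_bigr do rewrite contract_pure //.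
  rewrite (bigD1 i) //= fp eqxx rmorph1 mul1r big1 ?addr0 // => j ji.
  by rewrite fp eq_sym (negPf ji) rmorph0 mul0r.
by rewrite -[c i]sumE -[d i]sumE pcd.
Qed.

Lemma tensor_minimal A B (t : tensor_alg A B) :
  exists r (p : 'I_r -> A) (q : 'I_r -> B),
    [/\ lin_indep (p : _ -> lin_space A), lin_indep (q : _ -> lin_space B)
      & t = \sum_i pure (p i) (q i)].
Proof.
have [s ->] := tens_ex t; rewrite tens_sumE.
have [|||r [p [q [indp indq E]]]] := @minimal_tensor k (lin_space A) (lin_space B)
  (tensor A B) (fun a b => pure (a : A) (b : B)) s.
- exact: pureDl.
- exact: pureDr.
- exact: pureZ.
by exists r, p, q.
Qed.

End Homomorphisms.

(** * Finite-dimensional representations from comultiplication *)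

Section GroupFunctor.
Variables (n : nat) (k : sigmaField n) (H : groupFunctor k).
Variables (R S : sigmaAlgebra k) (f : sigmaHom R S).

Lemma gf_map1 : gf_map f (1%g : H R) = 1%g.
Proof. by apply: (@mulgI _ (gf_map f (1%g : H R))); rewrite -gf_mapM !mulg1. Qed.

Lemma gf_mapV (x : H R) : gf_map f x^-1%g = (gf_map f x)^-1%g.
Proof. by apply: (@mulgI _ (gf_map f x)); rewrite -gf_mapM !mulgV gf_map1. Qed.
End GroupFunctor.

Section Points.
Variables (n : nat) (k : sigmaField n) (G : sigmaAlgGroup k).
Local Notation A := (Defs.coord G).

Lemma ev_inj (R : sigmaAlgebra k) (x y : G R) : ev x =1 ev y -> x = y.
Proof. by move=> /sigmaHom_ext xy; rewrite -[x]evK xy evK. Qed.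

Lemma gf_map_pt (R S : sigmaAlgebra k) (f : sigmaHom R S) (g : sigmaHom A R) :
  gf_map f (pt g) = pt (compHom f g) :> G S.
Proof. by apply: ev_inj => a; rewrite ev_natural !ptK. Qed.

(** Any pair of points is the image of the universal pair, where the product is
comultiplication by definition. *)
Lemma ev_mul (R : sigmaAlgebra k) (x y : G R) I (s : seq I) (p q : I -> A) a :
  comult G a = \sum_(i <- s) pure (p i) (q i) ->
  ev (x * y)%g a = \sum_(i <- s) ev x (p i) * ev y (q i).
Proof.
move=> aE; pose h := pairing (ev x) (ev y).
have -> : (x * y)%g = gf_map h (pt (inlHom A A) * pt (inrHom A A))%g.
  by rewrite gf_mapM !gf_map_pt pairing_inl pairing_inr !evK.
rewrite ev_natural -[ev _ a]/(comult G a) aE.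
by rewrite (rmorph_sum h); apply: eq_bigr => i _; apply: pairing_pure.
Qed.

(** The matrix of a representation of G on a finite-dimensional space, expressed
on points instead of through comultiplication and counit. *)
Definition comatrix s (M : 'M[A]_s) : Prop :=
  (forall R (x y : G R),
     map_mx (ev (x * y)%g) M = map_mx (ev x) M *m map_mx (ev y) M) /\
  (forall R, map_mx (ev (1%g : G R)) M = 1%:M).

Definition entry_generated s (M : 'M[A]_s) (a : A) : Prop :=
  forall P : A -> Prop, subalgebra P -> (forall i j, P (M i j)) -> P a.

(** The representation on the span of the right translates of a. Tensoring the
ring R of the points with A adds a universal point, at which the values of a linearly
independent family remain independent over R. *)
Lemma ex_comatrix (a : A) :
  exists s (M : 'M[A]_s), comatrix M /\ entry_generated M a.
Proof.
have [r [p [q [indp indq aE]]]] := tensor_minimal (comult G a).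
have [f flin fq] := dual_functionals indq.
pose u i := tens_repr (comult G (q i)).
have uE i : comult G (q i) = \sum_(w <- u i) pure w.1 w.2.
  by rewrite -tens_sumE tens_reprK.
(* M i j is the coefficient of q j when comultiplication of q i is expanded along
   its right factor; f j computes it. *)
pose M : 'M[A]_r := \matrix_(i, j) \sum_(w <- u i) (f j w.2)%:k * w.1.
have inlr (R : sigmaAlgebra k) (b : A) (c : R) : inlHom A R b * inrHom A R c = pure b c.
  by rewrite [LHS]pureM mulr1 mul1r.
(* The span of p is a subrepresentation with matrix M: compare the coefficients
   of q j in the two expansions of a (X * Y * Z), with Z universal. *)
have evp R (x y : G R) j : ev (x * y)%g (p j) = \sum_i ev x (p i) * ev y (M i j).
  pose T := tensor_alg A R.
  pose X := gf_map (inrHom A R) x; pose Y := gf_map (inrHom A R) y.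
  pose Z : G T := pt (inlHom A R).
  have E1 : ev (X * Y * Z)%g a = \sum_i pure (q i) (ev (x * y)%g (p i)).
    rewrite (ev_mul _ _ aE); apply: eq_bigr => i _.
    by rewrite -gf_mapM ev_natural ptK mulrC inlr.
  have E2 : ev (X * Y * Z)%g a =
      \sum_i \sum_(w <- u i) pure w.2 (ev x (p i) * ev y w.1).
    rewrite -mulgA (ev_mul _ _ aE); apply: eq_bigr => i _.
    rewrite (ev_mul _ _ (uE i)) mulr_sumr; apply: eq_bigr => w _.
    by rewrite !ev_natural ptK mulrA -rmorphM mulrC inlr.
  have := congr1 (contract (f j)) (etrans (esym E1) E2).
  rewrite !contract_sum // (bigD1 j) //= contract_pure // fq eqxx rmorph1 mul1r.
  rewrite big1 ?addr0 => [->|i ij]; last first.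
    by rewrite contract_pure // fq eq_sym (negPf ij) rmorph0 mul0r.
  apply: eq_bigr => i _; rewrite mxE contract_sum // rmorph_sum mulr_sumr.
  by apply: eq_bigr => w _; rewrite contract_pure // rmorphM sh_in mulrCA.
(* M is multiplicative and unital: compare the coefficients of p i in the
   expansions of p j (X * Y * Z) and p j (X * 1), with X universal. *)
have comM : comatrix M.
  split=> [R x y|R]; apply/matrixP=> i j.
    pose T := tensor_alg A R; pose X : G T := pt (inlHom A R).
    pose Y := gf_map (inrHom A R) x; pose Z := gf_map (inrHom A R) y.
    pose c i := ev (x * y)%g (M i j).
    pose d i := \sum_l ev x (M i l) * ev y (M l j).
    suffices /lin_indep_tensor/(_ i) :
        \sum_i pure (p i) (c i) = \sum_i pure (p i) (d i).
      move=> /(_ indp) cd; rewrite [LHS]mxE [RHS]mxE [LHS]cd /d.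
      by apply: eq_bigr => l _; rewrite !mxE.
    transitivity (ev (X * (Y * Z))%g (p j)).
      rewrite evp; apply: eq_bigr => l _.
      by rewrite ptK -gf_mapM ev_natural inlr.
    rewrite mulgA evp; under eq_bigr do rewrite evp mulr_suml.
    rewrite exchange_big; apply: eq_bigr => l _.
    rewrite -inlr rmorph_sum mulr_sumr; apply: eq_bigr => m _.
    by rewrite ptK !ev_natural -mulrA -rmorphM.
  pose c i := ev (1%g : G R) (M i j); pose d i : R := (i == j)%:R.
  suffices /lin_indep_tensor/(_ i) :
        \sum_i pure (p i) (c i) = \sum_i pure (p i) (d i).
    by move=> /(_ indp) cd; rewrite [LHS]mxE [RHS]mxE [LHS]cd.
  transitivity (ev (pt (inlHom A R) * gf_map (inrHom A R) 1 : G _)%g (p j)).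
    by rewrite evp; apply: eq_bigr => l _; rewrite ptK ev_natural inlr.
  rewrite gf_map1 mulg1 ptK (bigD1 j) //= /d eqxx big1 ?addr0 // => l /negPf->.
  by rewrite -inlr rmorph0 mulr0.
exists r, M; split=> // P [Pk PD PM] PMij.
have Psum I (s : seq I) (c : I -> k) (b : I -> A) :
    (forall i, P (b i)) -> P (\sum_(i <- s) (c i)%:k * b i).
  by move=> Pb; apply: big_ind => [|//|i _]; [rewrite -(rmorph0 (sa_in A)) | apply: PM].
have ev1 b : ev (1%g : G A) b = (counit G b)%:k.
  pose h := @SigmaHom n k (base_alg k) A (sa_in A) (fun=> erefl) (@sa_inE n k A).
  by rewrite -(gf_map1 G h) ev_natural.
(* At the generic point g, an element of A is its own value. *)
pose g : G A := pt (idHom A).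
have evg b : ev g b = b by rewrite ptK.
have Pp j : P (p j).
  rewrite -[p j]evg -[g]mul1g evp.
  by under eq_bigr do rewrite ev1 evg; apply: Psum.
rewrite -[a]evg -[g]mulg1 (ev_mul _ _ aE).
by under eq_bigr do rewrite ev1 evg mulrC; apply: Psum.
Qed.
End Points.

(** * Closed embeddings *)

Section TensorKernel.
Variables (n : nat) (k : sigmaField n) (A B A' B' : sigmaAlgebra k).
Variables (f : sigmaHom A A') (g : sigmaHom B B').

Definition tensor_hom : sigmaHom (tensor_alg A B) (tensor_alg A' B') :=
  pairing (compHom (inlHom A' B') f) (compHom (inrHom A' B') g).

Lemma tensor_hom_pure a b : tensor_hom (pure a b) = pure (f a) (g b).
Proof. by rewrite [LHS]pairing_pure [LHS]pureM mulr1 mul1r. Qed.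

(** ker f (x) B + A (x) ker g *)
Let J (t : tensor A B) : Prop := exists s1 s2 : seq (A * B),
  [/\ forall p, p \in s1 -> f p.1 = 0, forall p, p \in s2 -> g p.2 = 0
    & t = tens_sum s1 + tens_sum s2].

Let J0 : J 0. Proof. by exists [::], [::]; rewrite addr0. Qed.

Let JD x y : J x -> J y -> J (x + y).
Proof.
move=> [s1 [s2 [s1f s2g ->]]] [t1 [t2 [t1f t2g ->]]].
exists (s1 ++ t1), (s2 ++ t2); rewrite !tens_sum_cat addrACA.
by split=> // p; rewrite mem_cat => /orP[];
  [apply: s1f|apply: t1f|apply: s2g|apply: t2g].
Qed.

Let Jl a b : f a = 0 -> J (pure a b).
Proof.
by exists [:: (a, b)], [::]; split=> // [p|]; [rewrite inE => /eqP-> | rewrite addr0].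
Qed.

Let Jr a b : g b = 0 -> J (pure a b).
Proof.
by exists [::], [:: (a, b)]; split=> // [p|]; [rewrite inE => /eqP-> | rewrite add0r].
Qed.

Let pureBl (a a' : A) (b : B) : pure (a - a') b = pure a b - pure a' b.
Proof. by apply: (addIr (pure a' b)); rewrite -pureDl !subrK. Qed.

Let pureBr (a : A) (b b' : B) : pure a (b - b') = pure a b - pure a b'.
Proof. by apply: (addIr (pure a b')); rewrite -pureDr !subrK. Qed.

Let JN x : J x -> J (- x).
Proof.
move=> [s1 [s2 [s1f s2g ->]]].
exists [seq (- p.1, p.2) | p <- s1], [seq (- p.1, p.2) | p <- s2].
split=> [_ /mapP[p ps ->]|_ /mapP[p ps ->]|]; first by rewrite /= rmorphN s1f ?oppr0.
  by rewrite /= s2g.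
by rewrite opprD -!tens_opp_sum.
Qed.

(** Set-theoretic sections l of f and m of g induce an additive inverse of
(A (x) B) / J -> A' (x) B': changing a preimage under f or g changes pure tensors
by an element of J only, so l and m respect each defining relation of the tensor
product modulo J. *)
Lemma tensor_hom_kernel t :
  (forall a', exists a, f a = a') -> (forall b', exists b, g b = b') ->
  tensor_hom t = 0 -> J t.
Proof.
move=> /choice[l fl] /choice[m gm] t0.
pose lift (s : seq (A' * B')) := \sum_(p <- s) pure (l p.1) (m p.2).
have liftJ s s' : tens_rel s s' -> J (lift s - lift s').
  elim=> {s s'}.
  - by move=> s; rewrite subrr.
  - by move=> s s' _ /JN; rewrite opprB.
  - by move=> s s' s'' _ J1 _ J2; have := JD J1 J2; rewrite addrA subrK.
  - by move=> s s' r r' _ J1 _ J2; have := JD J1 J2;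
    rewrite /lift !big_cat opprD addrACA.
  - by move=> s r; rewrite /lift !big_cat /= addrC subrr.
  - move=> a a' b; rewrite /lift !(big_cons, big_nil) !addr0 /= -pureDl -pureBl.
    by apply: Jl; rewrite rmorphB rmorphD !fl subrr.
  - move=> a b b'; rewrite /lift !(big_cons, big_nil) !addr0 /= -pureDr -pureBr.
    by apply: Jr; rewrite rmorphB rmorphD !gm subrr.
  - by move=> b; rewrite /lift !(big_cons, big_nil) !addr0 subr0; apply: Jl.
  - move=> c a b; rewrite /lift !(big_cons, big_nil) !addr0 /=.
    (* The two preimages of the common value are compared through
       c l(a) (x) m(b) = l(a) (x) c m(b). *)
    rewrite -(subrK (pure (c%:k * l a) (m b)) (pure (l _) _)) -addrA -pureBl.
    rewrite pureZ -pureBr; apply: JD.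
      by apply: Jl; rewrite rmorphB rmorphM sh_in !fl subrr.
    by apply: Jr; rewrite rmorphB rmorphM sh_in !gm subrr.
have [s tE] := tens_ex t; pose s' := [seq (f p.1, g p.2) | p <- s].
have /tens_sumP/liftJ : tens_sum s' = tens_sum [::].
  rewrite -[RHS]/(0 : tensor A' B') -t0 tE !tens_sumE big_map rmorph_sum.
  by apply: eq_bigr => p _; rewrite tensor_hom_pure.
rewrite /lift big_nil subr0 => Js'; rewrite -(subrK (lift s') t).
apply: JD => //; rewrite tE tens_sumE /lift big_map -sumrB.
apply: big_ind => // -[a b] _ /=.
rewrite -(subrK (pure (l (f a)) b) (pure a b)) -addrA -pureBl -pureBr.
by apply: JD; [apply: Jl | apply: Jr]; rewrite rmorphB ?fl ?gm subrr.
Qed.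
End TensorKernel.

Lemma sigmaHom_factor (n : nat) (k : sigmaField n) (A B R : sigmaAlgebra k)
    (f : sigmaHom A B) (h : sigmaHom A R) :
  (forall b, exists a, f a = b) -> (forall a, f a = 0 -> h a = 0) ->
  exists h' : sigmaHom B R, forall a, h' (f a) = h a.
Proof.
move=> /choice[l fl] fh.
have hE a b : f a = f b -> h a = h b.
  move=> ab; apply/eqP; rewrite -subr_eq0 -rmorphB; apply/eqP/fh.
  by rewrite rmorphB ab subrr.
pose h' b := h (l b).
have h'f a : h' (f a) = h a by apply: hE; rewrite fl.
have h'zmod : zmod_morphism h'.
  by move=> x y; rewrite /h' -rmorphB; apply: hE; rewrite rmorphB !fl.
have h'monoid : monoid_morphism h'.
  split=> [|x y]; first by rewrite -(rmorph1 h); apply: hE; rewrite fl rmorph1.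
  by rewrite /h' -rmorphM; apply: hE; rewrite rmorphM !fl.
pose zM := GRing.isZmodMorphism.Build B R h' h'zmod.
pose mM := GRing.isMonoidMorphism.Build B R h' h'monoid.
pose h'A : {additive B -> R} := HB.pack h' zM.
pose h'R : {rmorphism B -> R} := HB.pack h' zM mM.
have h'in c : h'R c%:k = c%:k.
  by rewrite -(sh_in h); apply: hE; rewrite fl sh_in.
have h'sigma j b : h'R ('s_j b) = 's_j (h'R b).
  by rewrite -sh_sigma; apply: hE; rewrite sh_sigma !fl.
by exists (SigmaHom h'in h'sigma).
Qed.

Lemma groupFunctor_iso_bij (n : nat) (k : sigmaField n) (G H : groupFunctor k)
    (f : groupFunctorHom G H) :
  (forall R, injective (f R)) -> (forall R y, exists x, f R x = y) ->
  groupFunctor_iso G H.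
Proof.
move=> finj fsurj.
pose g R y := sval (cid (fsurj R y)).
have fg R y : f R (g R y) = y by apply: (svalP (cid (fsurj R y))).
have gM R (x y : H R) : g R (x * y)%g = (g R x * g R y)%g.
  by apply: finj; rewrite gh_mapM !fg.
have gnat R S (h : sigmaHom R S) (x : H R) : g S (gf_map h x) = gf_map h (g R x).
  by apply: finj; rewrite gh_natural !fg.
exists f, (GroupFunctorHom gM gnat) => R; split=> [x|y]; last exact: fg.
by apply: finj; apply: fg.
Qed.

Section ClosedEmbedding.
Variables (n : nat) (k : sigmaField n) (G H : sigmaAlgGroup k).
Variable rho : groupFunctorHom G H.

(** By the Yoneda lemma, rho is determined by its value at the generic point. *)
Definition comorphism : sigmaHom (Defs.coord H) (Defs.coord G) :=
  ev (rho _ (pt (idHom (Defs.coord G)))).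

Lemma ev_comorphism (R : sigmaAlgebra k) (x : G R) b :
  ev (rho _ x) b = ev x (comorphism b).
Proof.
rewrite -{1}[x]evK -[ev x in LHS](_ : compHom (ev x) (idHom _) = _).
  by rewrite -gf_map_pt gh_natural ev_natural.
exact: sigmaHom_ext.
Qed.

Lemma pt_comorphism (R : sigmaAlgebra k) (f : sigmaHom (Defs.coord G) R) :
  pt (compHom f comorphism) = rho _ (pt f).
Proof. by apply: ev_inj => b; rewrite ev_comorphism !ptK. Qed.

(** The subgroup is the image of rho, cut out by the kernel of the comorphism: the
points of H that kill it are those that factor through coord G. *)
Lemma closed_embedding :
  (forall a, exists b, comorphism b = a) ->
  exists S : subgroupFunctor H, sigma_closed S /\ groupFunctor_iso G (sub_functor S).
Proof.
move=> surj.
have rho1 R : rho _ (1%g : G R) = 1%g.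
  by apply: (@mulgI _ (rho _ (1%g : G R))); rewrite -gh_mapM !mulg1.
have rhoV R (x : G R) : rho _ x^-1%g = (rho _ x)^-1%g.
  by apply: (@mulgI _ (rho _ x)); rewrite -gh_mapM !mulgV rho1.
pose mem R : {pred H R} := [pred y : H R | `[< exists x : G R, rho _ x = y >]].
have memP R (y : H R) : reflect (exists x : G R, rho _ x = y) (y \in mem R).
  exact: asboolP.
have mem_closed R : group_closed (mem R).
  split=> [|_ _ /memP[x <-] /memP[y <-]]; apply/memP; first by exists 1%g.
  by exists (x / y)%g; rewrite gh_mapM rhoV.
have mem_map R S (h : sigmaHom R S) (y : H R) : y \in mem R -> gf_map h y \in mem S.
  by move=> /memP[x <-]; apply/memP; exists (gf_map h x); rewrite gh_natural.
pose S := SubgroupFunctor mem_closed mem_map.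
have rho_inj R : injective (rho R).
  move=> x y xy; apply: ev_inj => a; have [b <-] := surj a.
  by rewrite -!ev_comorphism xy.
exists S; split.
  exists (fun b => comorphism b = 0); first split; first split.
  - split=> [|x y x0 y0|b x x0]; first exact: rmorph0.
      by rewrite rmorphD x0 y0 addr0.
    by rewrite rmorphM x0 mulr0.
  - move=> b b0; apply: (@tensor_hom_kernel _ _ _ _ _ _ comorphism comorphism) => //.
    rewrite /comult -ev_natural gf_mapM !gf_map_pt pairing_inl pairing_inr.
    by rewrite !pt_comorphism -gh_mapM ev_comorphism b0 rmorph0.
  - by move=> b b0; rewrite /counit -rho1 ev_comorphism b0 rmorph0.
  - move=> b b0; rewrite /antipode -ev_natural gf_mapV gf_map_pt.
    rewrite (_ : compHom _ _ = compHom (idHom _) comorphism); last exact: sigmaHom_ext.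
    by rewrite pt_comorphism -rhoV ev_comorphism b0 rmorph0.
  - by move=> j b b0; rewrite sh_sigma b0 rmorph0.
  move=> R y; split=> [/memP[x <-] b b0|y0]; first by rewrite ev_comorphism b0 rmorph0.
  have [h hE] := sigmaHom_factor surj y0.
  by apply/memP; exists (pt h); apply: ev_inj => b; rewrite ev_comorphism ptK hE.
pose f R (x : G R) : sub_functor S R :=
  exist _ (rho R x) (introT (memP R _) (ex_intro _ x erefl)).
have fM R (x y : G R) : f R (x * y)%g = (f R x * f R y)%g.
  by apply: val_inj; rewrite /= gh_mapM.
have fnat R T (h : sigmaHom R T) (x : G R) : f T (gf_map h x) = gf_map h (f R x).
  by apply: val_inj; rewrite /= gh_natural.
apply: (@groupFunctor_iso_bij _ _ _ _ (GroupFunctorHom fM fnat)) => R.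
  by move=> x y /(congr1 val); apply: rho_inj.
by move=> [y my]; have /memP[x xy] := my; exists x; apply: val_inj.
Qed.
End ClosedEmbedding.

(** * Embedding into the general linear group *)

Section LinearRepresentation.
Variables (n : nat) (k : sigmaField n) (G : sigmaAlgGroup k).
Local Notation A := (Defs.coord G).

Lemma comatrix_block s t (M : 'M[A]_s) (N : 'M[A]_t) :
  comatrix M -> comatrix N -> comatrix (block_mx M 0 0 N).
Proof.
move=> [MM M1] [NM N1]; split=> [R x y|R].
  rewrite !map_block_mx !map_mx0 mulmx_block MM NM.
  by rewrite !mulmx0 !mul0mx !add0r !addr0.
by rewrite map_block_mx !map_mx0 M1 N1 -scalar_mx_block.
Qed.

Lemma ex_comatrix_seq (gens : seq A) :
  exists s (M : 'M[A]_s), [/\ (0 < s)%N, comatrix M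
    & forall a, a \in gens -> entry_generated M a].
Proof.
elim: gens => [|a gens [s [M [s0 cM genM]]]].
  (* The trivial representation on k, so that the size stays positive. *)
  exists 1, 1%:M; split=> //.
  by split=> *; rewrite !map_mx1 ?mulmx1.
have [t [N [cN genN]]] := ex_comatrix a.
exists (t + s)%N, (block_mx N 0 0 M).
split; [by rewrite addn_gt0 s0 orbT | exact: comatrix_block |].
move=> b; rewrite inE => /orP[/eqP->|/genM gb] P subP PMN.
  by apply: genN subP _ => i j; rewrite -(block_mxEul N 0 0 M).
by apply: gb subP _ => i j; rewrite -(block_mxEdr N 0 0 M).
Qed.

Section OfComatrix.
Variables (s : nat) (M : 'M[A]_s).
Hypothesis cM : comatrix M.

Fact comatrix_invertible (R : sigmaAlgebra k) (x : G R) :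
  invertible (map_mx (ev x) M).
Proof.
apply/asboolP; exists (map_mx (ev x^-1%g) M).
by rewrite -!cM.1 mulgV mulVg cM.2.
Qed.

Definition rep_fun (R : sigmaAlgebra k) (x : G R) : GL k s R :=
  GLmx (comatrix_invertible x).

Fact rep_funM (R : sigmaAlgebra k) (x y : G R) :
  rep_fun (x * y)%g = (rep_fun x * rep_fun y)%g.
Proof. by apply: val_inj; apply: cM.1. Qed.

Fact rep_fun_natural (R S : sigmaAlgebra k) (f : sigmaHom R S) (x : G R) :
  rep_fun (gf_map f x) = gf_map f (rep_fun x).
Proof. by apply: val_inj; apply/matrixP=> i j; rewrite !mxE ev_natural. Qed.

Definition rep : groupFunctorHom G (GL k s) :=
  GroupFunctorHom rep_funM rep_fun_natural.

Lemma comorphism_rep i j : comorphism rep (GLvar k false i j) = M i j.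
Proof. by rewrite [LHS]GLval_cls /= mxE ptK. Qed.

(** The image of the comorphism is a subalgebra stable under every sigma_j; it
contains the entries of M, hence the generators, hence their translates. *)
Lemma comorphism_rep_surj (gens : seq A) :
  sigma_generates gens -> (forall a, a \in gens -> entry_generated M a) ->
  forall a, exists b, comorphism rep b = a.
Proof.
move=> gensA gensM; set phi := comorphism rep.
have im_sub : subalgebra (fun a => exists b, phi b = a).
  split=> [c|_ _ [x <-] [y <-]|_ _ [x <-] [y <-]].
  - by exists c%:k; rewrite sh_in.
  - by exists (x + y); rewrite rmorphD.
  - by exists (x * y); rewrite rmorphM.
apply: gensA => // w a /gensM /(_ _ im_sub) [|b <-].
  by move=> i j; exists (GLvar k false i j); apply: comorphism_rep.
exists (sigma_word w b); elim: w => //= j w <-.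
exact: (sh_sigma phi).
Qed.
End OfComatrix.
End LinearRepresentation.

Theorem proposition3p13 (n : nat) (hn : (1 <= n)%N) (k : sigmaField n)
    (G : sigmaAlgGroup k) :
  exists s : nat, (1 <= s)%N /\
    exists S : subgroupFunctor (GL k s),
      sigma_closed S /\ groupFunctor_iso G (sub_functor S).
Proof.
have [gens gensA] := coord_fg G.
have [s [M [s0 cM gensM]]] := ex_comatrix_seq gens.
exists s; split=> //; apply: (@closed_embedding _ _ _ _ (rep cM)).
exact: comorphism_rep_surj gensA gensM.
Qed.
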